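(* If two finite lattices $L$ and $K$ are SSP, then the product lattice $L \times K$ is SSP.
   Context: All posets are finite. For a lattice $M$, a family (subset) $F \subseteq M$ shatters $y \in M$ if for every $x \le y$ there exists $z \in F$ with $z \wedge y = x$; $\mathrm{Str}(F)$ is the set of all elements of $M$ shattered by $F$. A lattice $M$ is SSP if $|F| \le |\mathrm{Str}(F)|$ for every $F \subseteq M$. The product $L \times K$ is the Cartesian product with order $(\ell_1,k_1) \le (\ell_2,k_2)$ iff $\ell_1 \le \ell_2$ and $k_1 \le k_2$. *)

(* Defs.v *)
From mathcomp Require Import all_boot all_order.

Set Implicit Arguments.
Unset Strict Implicit.
Unset Printing Implicit Defensive.

Import Order.Theory.

Definition shatters (d : Order.disp_t) (M : finLatticeType d)
    (F : {set M}) (y : M) : bool :=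
  [forall x : M, (x <= y)%O ==> [exists z in F, (z `&` y)%O == x]].

Definition Str (d : Order.disp_t) (M : finLatticeType d) (F : {set M}) :
    {set M} :=
  [set y | shatters F y].

Definition SSP (d : Order.disp_t) (M : finLatticeType d) : Prop :=
  forall F : {set M}, #|F| <= #|Str F|.

(* Main.v *)
Require Import Defs.
From mathcomp Require Import all_boot all_order.

(** Let [F] be a family in the product. Replace each horizontal fibre
    [F_k = {l | (l, k) in F}] by [Str F_k]: since [L] is SSP, the resulting set
    of pairs is at least as large as [F]. Then replace each vertical fibre
    [G_l = {k | l in Str F_k}] of that set by [Str G_l]: since [K] is SSP, the
    size does not decrease. Every pair [(l, k)] so obtained is shattered
    by [F] ([Str_fibres]): given [(x, y) <= (l, k)], shattering of [k] by [G_l]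
    provides [k'] with meet [y], and then shattering of [l] by [F_k'] provides
    [l'] with meet [x], where [(l', k')] lies in [F]. *)

Lemma shattersP (d : Order.disp_t) (M : finLatticeType d) (F : {set M}) (y : M) :
  reflect (forall x, (x <= y)%O -> exists2 z, z \in F & (z `&` y)%O = x)
          (y \in Str F).
Proof.
rewrite inE; apply: (iffP forallP) => [sh x le_xy | sh x].
  by have /implyP/(_ le_xy)/exists_inP[z Fz /eqP] := sh x; exists z.
by apply/implyP => /sh[z Fz zyx]; apply/exists_inP; exists z => //; apply/eqP.
Qed.

Lemma card_fibres_snd (S T : finType) (A : {set S * T}) :
  #|A| = \sum_(t : T) #|[set s | (s, t) \in A]|.
Proof.
rewrite -sum1_card (eq_bigl (fun p => (p.1, p.2) \in A)); last by case.
rewrite -(pair_big_dep xpredT (fun s t => (s, t) \in A) (fun _ _ => 1)) /=.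
rewrite (exchange_big_dep xpredT) //=.
by apply: eq_bigr => t _; rewrite -sum1_card; apply: eq_bigl => s; rewrite inE.
Qed.

Lemma card_fibres_fst (S T : finType) (A : {set S * T}) :
  #|A| = \sum_(s : S) #|[set t | (s, t) \in A]|.
Proof.
rewrite -sum1_card (eq_bigl (fun p => (p.1, p.2) \in A)); last by case.
rewrite -(pair_big_dep xpredT (fun s t => (s, t) \in A) (fun _ _ => 1)) /=.
by apply: eq_bigr => s _; rewrite -sum1_card; apply: eq_bigl => t; rewrite inE.
Qed.

Lemma Str_fibres (dL dK : Order.disp_t)
    (L : finLatticeType dL) (K : finLatticeType dK)
    (F : {set (L *p K)%type}) (l : L) (k : K) :
  k \in Str [set k' | l \in Str [set l' | (l', k') \in F]] ->
  ((l, k) : (L *p K)%type) \in Str F.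
Proof.
move=> /shattersP shk; apply/shattersP => -[x y].
rewrite Order.ProdOrder.leEprod /= => /andP[le_xl le_yk].
have [k' + meet_k] := shk y le_yk; rewrite inE => /shattersP/(_ x le_xl)[l'].
rewrite inE => Fl'k' meet_l; exists (l', k') => //.
by rewrite Order.ProdOrder.meetEprod /= meet_l meet_k.
Qed.

(* [L *p K] is the library's cartesian product with the componentwise order. *)
Theorem theorem1p6 (dL dK : Order.disp_t)
    (L : finLatticeType dL) (K : finLatticeType dK) :
  SSP L -> SSP K -> SSP (L *p K)%type.
Proof.
move=> sspL sspK F.
pose B : {set L * K} := [set p | p.1 \in Str [set l | (l, p.2) \in F]].
have le_FB : #|F| <= #|B|.
  rewrite (@card_fibres_snd L K F) (@card_fibres_snd L K B).
  apply: leq_sum => k _; apply: leq_trans (sspL _) _.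
  by apply: subset_leq_card; apply/subsetP => l; rewrite !in_set.
apply: leq_trans le_FB _.
rewrite (@card_fibres_fst L K B) (@card_fibres_fst L K (Str F)).
apply: leq_sum => l _; apply: leq_trans (sspK _) _.
apply: subset_leq_card; apply/subsetP => k shk; rewrite in_set.
apply: Str_fibres; move: shk; congr (_ \in Str _).
by apply/setP => k'; rewrite !in_set.
Qed.
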